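(* Let $n\ge1$, $\lambda\in[0,1)$, and let $A$ be an intuitionistic fuzzy matrix of order $n$ such that the powers $A^m$ with respect to the operation $*$ (defined below) converge entrywise (in both components) to a matrix $\hat A$. Then for each $1\le j\le n$: $\hat A_{sj}=\langle 1,0\rangle$ for all $s=1,\dots,n$ if and only if there is a critical path in the associated digraph $G$ from a critical vertex to the vertex $j$.
   Context: An intuitionistic fuzzy matrix (IFM) of order $n$ is an $n\times n$ matrix with entries $a_{ij}=\langle a_{ij\mu},a_{ij\nu}\rangle$, where $a_{ij\mu},a_{ij\nu}\in[0,1]$ and $a_{ij\mu}+a_{ij\nu}\le1$. For IFMs $A,B$ of order $n$ define $$[A*B]_{ij}=\Big\langle \max_{1\le t\le n}\Big\{\lambda\min(a_{it\mu},b_{tj\mu})+(1-\lambda)\tfrac{a_{it\mu}+b_{tj\mu}}{2}\Big\},\ \min_{1\le t\le n}\Big\{\lambda\max(a_{it\nu},b_{tj\nu})+(1-\lambda)\tfrac{a_{it\nu}+b_{tj\nu}}{2}\Big\}\Big\rangle.$$ Powers: $A^1=A$, $A^k=A^{k-1}*A$ for $k\ge2$. The digraph $G$ associated with $A$ has vertex set $\{1,\dots,n\}$ and every ordered pair $(i,j)$ (including loops) as an edge, the edge $(i,j)$ carrying the value $a_{ij}$. A path of length $k\ge1$ is a sequence of edges $(i_0,i_1),(i_1,i_2),\dots,(i_{k-1},i_k)$ (vertices may repeat); it is a critical path from $i_0$ to $i_k$ if $a_{i_{l-1}i_l}=\langle1,0\rangle$ for all $l=1,\dots,k$. A circuit of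 length $k\ge1$ is such a path with $i_k=i_0$ and $i_1,\dots,i_{k-1}$ distinct; it is a critical circuit if all its edges carry $\langle1,0\rangle$. A vertex lying on some critical circuit is a critical vertex. *)

(* Defs.v *)
From mathcomp Require Import all_boot all_order all_algebra.
From mathcomp Require Import classical_sets reals topology normedtype.

Set Implicit Arguments.
Unset Strict Implicit.
Unset Printing Implicit Defensive.

Import Order.TTheory GRing.Theory Num.Theory.
Import numFieldNormedType.Exports.

Local Open Scope ring_scope.

(* An entry <mu, nu> is a pair: first component membership, second
   component non-membership. *)
Definition is_ifm (R : realType) (n : nat) (A : 'M[R * R]_n) : Prop :=
  forall i j, [/\ 0 <= (A i j).1 <= 1, 0 <= (A i j).2 <= 1
                & (A i j).1 + (A i j).2 <= 1].

(* For n >= 1 the neutral elements 0 of the maximum and 1 of the minimum do not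
   affect the result, because all the terms lie in [0, 1] when A and B are
   intuitionistic fuzzy matrices and lam is in [0, 1]. *)
Definition ifm_mul (R : realType) (n : nat) (lam : R) (A B : 'M[R * R]_n) :
    'M[R * R]_n :=
  \matrix_(i, j)
    (\big[Num.max/0]_(t < n)
        (lam * Num.min (A i t).1 (B t j).1
         + (1 - lam) * (((A i t).1 + (B t j).1) / 2)),
     \big[Num.min/1]_(t < n)
        (lam * Num.max (A i t).2 (B t j).2
         + (1 - lam) * (((A i t).2 + (B t j).2) / 2))).

(* A^1 = A and A^k = A^(k-1) * A for k >= 2; the value at k = 0 is junk. *)
Definition ifm_pow (R : realType) (n : nat) (lam : R) (A : 'M[R * R]_n)
    (k : nat) : 'M[R * R]_n :=
  iter k.-1 (fun B => ifm_mul lam B A) A.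

Definition ifm_pow_cvg (R : realType) (n : nat) (lam : R)
    (A Ahat : 'M[R * R]_n) : Prop :=
  forall i j,
    ((fun m : nat => (ifm_pow lam A m i j).1) @ \oo --> (Ahat i j).1)%classic /\
    ((fun m : nat => (ifm_pow lam A m i j).2) @ \oo --> (Ahat i j).2)%classic.

(* Every ordered pair of vertices is an edge of the digraph, so the path
   (i_0, i_1), ..., (i_(k-1), i_k) is given by i_0 = i and the sequence
   p = [:: i_1; ...; i_k] of its other vertices; its length is size p. *)
Definition digraph_path (n : nat) (i : 'I_n) (p : seq 'I_n) (j : 'I_n) : bool :=
  (0 < size p)%N && (last i p == j).

Definition critical_edge (R : realType) (n : nat) (A : 'M[R * R]_n) :
    rel 'I_n :=
  fun i j => A i j == (1, 0).

Definition critical_path (R : realType) (n : nat) (A : 'M[R * R]_n)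
    (i : 'I_n) (p : seq 'I_n) (j : 'I_n) : bool :=
  digraph_path i p j && path (critical_edge A) i p.

(* behead (belast i p) is [:: i_1; ...; i_(k-1)]. *)
Definition digraph_circuit (n : nat) (i : 'I_n) (p : seq 'I_n) : bool :=
  digraph_path i p i && uniq (behead (belast i p)).

Definition critical_circuit (R : realType) (n : nat) (A : 'M[R * R]_n)
    (i : 'I_n) (p : seq 'I_n) : bool :=
  digraph_circuit i p && path (critical_edge A) i p.

Definition critical_vertex (R : realType) (n : nat) (A : 'M[R * R]_n)
    (v : 'I_n) : Prop :=
  exists i p, critical_circuit A i p /\ v \in i :: p.

(* Main.v *)
(* Along a walk the entries of A are combined one edge at a time.  Measured by
   its distance to <1, 0>, the value of a walk is multiplied by
   (1 + lam) / 2 < 1 when a critical edge is appended, and it is multiplied by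
   at least (1 - lam) / 2 > 0 whatever edge is appended.  Hence the powers tend
   to <1, 0> in column j if arbitrarily long critical walks end at j; otherwise
   every long walk to j has a non-critical edge among its last N edges, which
   keeps its first component away from 1.  By finiteness, arbitrarily long
   critical walks end at j iff a critical path leads from a critical vertex to
   j. *)
Require Import Defs.
From mathcomp Require Import all_boot all_order all_algebra.
From mathcomp Require Import classical_sets reals topology normedtype.
From mathcomp Require Import sequences.
From mathcomp Require Import lra.

Set Implicit Arguments.
Unset Strict Implicit.
Unset Printing Implicit Defensive.

Import Order.TTheory GRing.Theory Num.Theory.
Import numFieldNormedType.Exports.

Local Open Scope ring_scope.

Section WalksInFiniteDigraphs.
Variables (T : finType) (e : rel T).

(** The recursion runs backwards from the endpoint because [ifm_pow] appends edges on the right. *)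
Fixpoint ending_walk (k : nat) (y : T) : bool :=
  if k is k'.+1 then [exists x, e x y && ending_walk k' x] else true.

Lemma ending_walkP k y :
  reflect (exists x p, [/\ path e x p, last x p = y & size p = k])
          (ending_walk k y).
Proof.
apply: (iffP idP) => [|[x [p [+ + <-]]]].
  elim: k y => [|k IHk] y /=; first by exists y, [::].
  move=> /existsP[z /andP[ezy /IHk[x [p [ep pz <-]]]]].
  by exists x, (rcons p y); rewrite rcons_path ep pz ezy last_rcons size_rcons.
elim/last_ind: p y => [//|p z IHp] y.
rewrite rcons_path last_rcons size_rcons => /andP[ep ez] <- /=.
by apply/existsP; exists (last x p); rewrite ez IHp.
Qed.

Lemma path_ending_walk x p :
  (forall k, ending_walk k x) -> path e x p ->
  forall k, ending_walk k (last x p).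
Proof.
elim: p x => [//|y p IHp] x walk_x /= /andP[exy /IHp]; apply => -[//|k] /=.
by apply/existsP; exists x; rewrite exy walk_x.
Qed.

Lemma cycle_ending_walk p x k : cycle e p -> x \in p -> ending_walk k x.
Proof.
move=> ep; elim: k x => [//|k IHk] x px /=.
by apply/existsP; exists (prev p x); rewrite prev_cycle ?IHk ?mem_prev.
Qed.

(** Prepares the pigeonhole argument: dropping everything before a repeated vertex [z] leaves a
    closed walk at [z] and then a walk to the old endpoint. *)
Lemma nonuniq_path x p :
  path e x p -> ~~ uniq (x :: p) ->
  exists z q1 q2,
    path e z (rcons q1 z ++ q2) /\ last z (rcons q1 z ++ q2) = last x p.
Proof.
elim: p x => [//|y p IHp] x ep; rewrite cons_uniq negb_and negbK.
case/orP=> [/path.splitP def_p|nu].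
  by case: def_p ep => q1 q2 ep; exists x, q1, q2.
by apply: IHp nu; case/andP: ep.
Qed.

End WalksInFiniteDigraphs.

Section CriticalWalks.
Variables (R : realType) (n : nat) (A : 'M[R * R]_n).

Lemma closed_walk_critical_vertex z q :
  path (critical_edge A) z (rcons q z) -> critical_vertex A z.
Proof.
(* Shortening the part before the closing edge makes its vertices distinct, as a circuit
   requires. *)
rewrite rcons_path => /andP[eq]; case: (shortenP eq) => q' eq' uq' _ ez.
exists z, (rcons q' z); split; last by rewrite inE eqxx.
rewrite /critical_circuit /digraph_circuit /digraph_path size_rcons last_rcons.
by rewrite eqxx belast_rcons rcons_path eq' ez /= andbT; case/andP: uq'.
Qed.

Lemma critical_vertex_ending_walk v k :
  critical_vertex A v -> ending_walk (critical_edge A) k v.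
Proof.
move=> [i [p [/andP[/andP[/andP[p_gt0 /eqP lp] _] ep] vp]]].
have cp : cycle (critical_edge A) p by rewrite (cycle_path i) lp.
apply: cycle_ending_walk cp _; move: vp; rewrite inE => /predU1P[->|//].
by case: p p_gt0 lp {ep} => //= x p _ <-; apply: mem_last.
Qed.

Lemma critical_path_ending_walk j :
  (exists v p, critical_vertex A v /\ critical_path A v p j) <->
  (forall k, ending_walk (critical_edge A) k j).
Proof.
split=> [[v [p [cv /andP[/andP[_ /eqP <-] ep]]]]|walk_j].
  by apply: path_ending_walk ep => k; apply: critical_vertex_ending_walk.
(* A walk of length [n] visits [n + 1] vertices, so one of them repeats. *)
have /ending_walkP[x [p [ep lp sp]]] := walk_j n.
have nu : ~~ uniq (x :: p).
  apply/negP => /card_uniqP /= cp; have := max_card (mem (x :: p)).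
  by rewrite cp card_ord sp ltnn.
have [z [q1 [q2 [eq lq]]]] := nonuniq_path ep nu.
exists z, (rcons q1 z ++ q2); split.
  by move: eq; rewrite cat_path => /andP[/closed_walk_critical_vertex].
by rewrite /critical_path /digraph_path eq lq lp eqxx size_cat size_rcons.
Qed.

End CriticalWalks.

Section MixedMeans.
Variables (R : realFieldType) (lam : R).
Hypothesis hlam : 0 <= lam < 1.
Implicit Types (x y z a b : R).

(** Here [z] stands for the minimum and is only bounded by 1; the deficits [a] and [b] survive
    through the arithmetic mean. *)
Lemma mixed_mean_le x y z a b :
  z <= 1 -> x <= 1 - a -> y <= 1 - b ->
  lam * z + (1 - lam) * ((x + y) / 2) <= 1 - (1 - lam) / 2 * (a + b).
Proof.
case/andP: hlam => lam_ge0 lam_lt1 hz hx hy.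
have h1 : 0 <= lam * (1 - z) by apply: mulr_ge0; lra.
have h2 : 0 <= (1 - lam) * (2 - a - b - x - y) by apply: mulr_ge0; lra.
lra.
Qed.

(** The deficit [a] enters with weight [lam] from the minimum and [(1 - lam) / 2] from the mean with
    1. *)
Lemma mixed_mean_ge x z a :
  1 - a <= z -> 1 - a <= x ->
  1 - (1 + lam) / 2 * a <= lam * z + (1 - lam) * ((x + 1) / 2).
Proof.
case/andP: hlam => lam_ge0 lam_lt1 hz hx.
have h1 : 0 <= lam * (z - (1 - a)) by apply: mulr_ge0; lra.
have h2 : 0 <= (1 - lam) * (x - (1 - a)) by apply: mulr_ge0; lra.
lra.
Qed.

End MixedMeans.

Section Powers.
Variables (R : realType) (n : nat) (lam : R) (A : 'M[R * R]_n).
Hypotheses (hlam : 0 <= lam < 1) (hA : is_ifm A).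

Lemma ifm_powS m : (0 < m)%N ->
  ifm_pow lam A m.+1 = ifm_mul lam (ifm_pow lam A m) A.
Proof. by case: m. Qed.

Lemma ifm_pow_bounds m i j :
  (ifm_pow lam A m i j).1 <= 1 /\ 0 <= (ifm_pow lam A m i j).2.
Proof.
have A1 s t : (A s t).1 <= 1 by have [/andP[]] := hA s t.
have A2 s t : 0 <= (A s t).2 by have [_ /andP[]] := hA s t.
case/andP: (hlam) => lam_ge0 lam_lt1.
case: m => [//|m]; elim: m i j => [//|m IHm] i j.
rewrite ifm_powS // mxE /=; split.
  apply: bigmax_le => // t _; have [h _] := IHm i t.
  have := @mixed_mean_le _ _ hlam (ifm_pow lam A m.+1 i t).1 (A t j).1
    (Num.min (ifm_pow lam A m.+1 i t).1 (A t j).1) 0 0.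
  by rewrite !subr0 addr0 mulr0 subr0; apply; rewrite // ge_min h.
apply: le_bigmin => // t _; have [_ h] := IHm i t.
rewrite addr_ge0 // mulr_ge0 ?le_max ?h // ?subr_ge0 ?(ltW lam_lt1) //.
by rewrite divr_ge0 ?addr_ge0.
Qed.

(** The power is [k.+1] because an arbitrary edge from [s] leads to the start of the critical walk;
    its distance to <1, 0> is at most 1, and each of the [k] critical edges contracts it. *)
Lemma ending_walk_pow_near k s j :
  ending_walk (critical_edge A) k j ->
  1 - ((1 + lam) / 2) ^+ k <= (ifm_pow lam A k.+1 s j).1 /\
  (ifm_pow lam A k.+1 s j).2 <= ((1 + lam) / 2) ^+ k.
Proof.
case/andP: (hlam) => lam_ge0 lam_lt1; set r := (1 + lam) / 2.
have r_ge0 : 0 <= r by rewrite /r; lra.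
elim: k j => [|k IHk] j /=.
  by have [/andP[? _] /andP[_ ?] _] := hA s j; rewrite expr0 subrr.
move=> /existsP[t /andP[/eqP At /IHk[IH1 IH2]]].
have rk_ge0 : 0 <= r ^+ k by rewrite exprn_ge0.
rewrite ifm_powS // mxE /= exprS; split.
  apply: (bigmax_sup t) => //; rewrite At /=.
  by apply: mixed_mean_ge => //; rewrite le_min IH1; lra.
apply: (bigmin_inf t) => //; rewrite At /=.
(* The substitution nu = 1 - mu reduces the second component to the first. *)
have := @mixed_mean_ge _ _ hlam (1 - (ifm_pow lam A k.+1 s t).2)
  (1 - Num.max (ifm_pow lam A k.+1 s t).2 0) (r ^+ k).
rewrite -/r !lerD2l !lerN2 ge_max IH2 rk_ge0 => /(_ isT isT); lra.
Qed.

(** There are finitely many edges, and a first component 1 forces the second to be 0, since they sum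
    to at most 1. *)
Lemma noncritical_gap :
  exists2 d : R, 0 < d <= 1 &
    forall i j, ~~ critical_edge A i j -> (A i j).1 <= 1 - d.
Proof.
(* The default 1 gives [d <= 1] and covers the case where all edges are critical. *)
pose d : R := \big[Num.min/1]_(u : 'I_n * 'I_n | ~~ critical_edge A u.1 u.2)
  (1 - (A u.1 u.2).1).
exists d => [|i j nij].
  rewrite bigmin_le_id andbT; apply: lt_bigmin => // -[i j] /= nij.
  have [/andP[_ a1_le1] /andP[a2_ge0 _] a12] := hA i j.
  rewrite subr_gt0 lt_neqAle a1_le1 andbT; apply: contraNneq nij => a1.
  rewrite /critical_edge; case: (A i j) a1 a2_ge0 a12 => a b /= -> b_ge0 ab.
  by rewrite xpair_eqE eqxx eq_le b_ge0 andbT; lra.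
by rewrite lerBrDl -lerBrDr; apply: (bigmin_le_cond 1 (j := (i, j))).
Qed.

(** Induction on [N]: either the last edge is non-critical and brings the deficit [d] itself, or its
    source ends no critical walk of length [N - 1] and the deficit comes from the shorter power. The
    case [N = 0] is vacuous. *)
Lemma no_ending_walk_pow_far d N m s j :
  0 < d <= 1 ->
  (forall i j', ~~ critical_edge A i j' -> (A i j').1 <= 1 - d) ->
  ~~ ending_walk (critical_edge A) N j -> (N < m)%N ->
  (ifm_pow lam A m s j).1 <= 1 - ((1 - lam) / 2) ^+ N * d.
Proof.
case/andP: (hlam) => lam_ge0 lam_lt1; set c := (1 - lam) / 2.
move=> /andP[d_gt0 d_le1] gap.
have c_ge0 : 0 <= c by rewrite /c; lra.
have c_le1 : c <= 1 by rewrite /c; lra.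
have cN_le1 k : c ^+ k <= 1 by rewrite exprn_ile1.
have cN_ge0 k : 0 <= c ^+ k by rewrite exprn_ge0.
elim: N m j => [//|N IHN] [//|m] j /=; rewrite negb_exists ltnS => /forallP nw Nm.
rewrite ifm_powS; last exact: leq_ltn_trans Nm.
rewrite mxE /=; apply: bigmax_le => [|t _].
  (* The bound must also dominate the default 0 of the maximum. *)
  by rewrite subr_ge0 mulr_ile1 // ltW.
have [B_le1 _] := ifm_pow_bounds m s t.
have [/andP[_ A_le1] _ _] := hA t j.
have z_le1 : Num.min (ifm_pow lam A m s t).1 (A t j).1 <= 1.
  by rewrite ge_min B_le1.
have := nw t; rewrite negb_and => /orP[/gap A_le|/IHN/(_ Nm) B_le].
  have B_le : (ifm_pow lam A m s t).1 <= 1 - 0 by rewrite subr0.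
  apply: le_trans (mixed_mean_le hlam z_le1 B_le A_le) _.
  rewrite -/c add0r lerD2l lerN2 exprS -mulrA ler_wpM2l //.
  by rewrite ler_piMl // ltW.
have A_le : (A t j).1 <= 1 - 0 by rewrite subr0.
apply: le_trans (mixed_mean_le hlam z_le1 B_le A_le) _.
by rewrite -/c addr0 exprS mulrA.
Qed.

End Powers.

Theorem theorem4p6 (R : realType) (n : nat) (hn : (0 < n)%N)
    (lam : R) (hlam : 0 <= lam < 1)
    (A : 'M[R * R]_n) (hA : is_ifm A)
    (Ahat : 'M[R * R]_n) (hcvg : ifm_pow_cvg lam A Ahat) (j : 'I_n) :
  (forall s : 'I_n, Ahat s j = (1, 0)) <->
  (exists (v : 'I_n) (p : seq 'I_n),
      critical_vertex A v /\ critical_path A v p j).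
Proof.
rewrite critical_path_ending_walk; case/andP: (hlam) => lam_ge0 lam_lt1.
split=> [Ahat_j N|walk_j s].
  apply/negPn/negP => nw; have [d d01 gap] := noncritical_gap hA.
  (* One row and its first component suffice: the uniform gap below 1 passes to the limit. *)
  have [cvg1 _] := hcvg (Ordinal hn) j; rewrite Ahat_j in cvg1.
  have : 1 <= 1 - ((1 - lam) / 2) ^+ N * d.
    apply: (ler_cvg_to cvg1 (cvg_cst _)); exists N.+1 => // m /= Nm.
    exact: no_ending_walk_pow_far.
  rewrite lerBrDr gerDl leNgt mulr_gt0 ?exprn_gt0 //; last by case/andP: d01.
  by lra.
have [cvg1 cvg2] := hcvg s j.
have cvg_r : ((fun k => ((1 + lam) / 2) ^+ k) @ \oo --> (0 : R))%classic.
  by apply: cvg_expr; rewrite ger0_norm; lra.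
(* The estimates for walks of length [k] concern the power [k.+1], so the sequences are shifted. *)
have cvg1S := cvg_comp _ _ (cvg_addnr 1) cvg1.
have cvg2S := cvg_comp _ _ (cvg_addnr 1) cvg2.
have near1 k := (ending_walk_pow_near hlam hA s (walk_j k)).1.
have near2 k := (ending_walk_pow_near hlam hA s (walk_j k)).2.
have bnd m := ifm_pow_bounds hlam hA m s j.
rewrite [Ahat s j]surjective_pairing; congr pair; apply/eqP; rewrite eq_le.
  apply/andP; split.
    by apply: (ler_cvg_to cvg1 (cvg_cst _)); exists 0%N => // m _; case: (bnd m).
  rewrite -[X in X <= _](subr0 (1 : R)).
  apply: (ler_cvg_to (cvgB (cvg_cst (1 : R)) cvg_r) cvg1S).
  by exists 0%N => // k _; have := near1 k; rewrite -[k.+1]addn1.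
apply/andP; split.
  apply: (ler_cvg_to cvg2S cvg_r).
  by exists 0%N => // k _; have := near2 k; rewrite -[k.+1]addn1.
by apply: (ler_cvg_to (cvg_cst _) cvg2); exists 0%N => // m _; case: (bnd m).
Qed.
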